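(* Let $H$ be the graph on vertex set $\{0,1,2,3\}$ with red edge set $\{\{0,1\},\{1,2\}\}$ and blue edge set $\{\{0,2\},\{0,3\}\}$. Then $\lambda_H=1/8$, the semi-inducibility problem for $H$ is perfectly $K_2$-stable, and the unique maximizer of $\lambda_H(K_2(\mathbf a))$ over vectors $\mathbf a$ of two non-negative reals summing to $1$ is $\mathbf a=(1/2,1/2)$.
   Context: All graphs are finite and simple; the order of a graph is its number of vertices. For a graph $H$ with $\kappa$ vertices whose edges are coloured red or blue and an uncoloured graph $G$ of order $n\ge\kappa$, an embedding of $H$ into $G$ is an injection $V(H)\to V(G)$ that maps red edges of $H$ to edges of $G$ and blue edges of $H$ to non-edges of $G$ (pairs of distinct non-adjacent vertices). $\Lambda_H(G)$ is the number of embeddings, $\lambda_H(G):=\Lambda_H(G)/\big(n(n-1)\cdots(n-\kappa+1)\big)$, $\lambda_H(n)$ is the maximum of $\lambda_H(G)$ over all graphs $G$ of order $n$, and $\lambda_H:=\lim_{n\to\infty}\lambda_H(n)$ (the limit exists). For a graph $B$ on $\{0,\dots,m-1\}$ and pairwise disjoint finite sets $V_0,\dots,V_{m-1}$ (some possibly empty), the blowup $B(V_0,\dots,V_{m-1})$ is the graph on $\bigcup_i V_i$ in which $x\in V_i$ and $y\in V_j$ are adjacent if and only if $\{i,j\}\in E(B)$. For a vector $\mathbf a=(a_0,\dots,a_{m-1})$ of non-negative reals summing to $1$, $\lambda_H(B(\mathbf a))$ denotes the limit as $n\to\infty$ of $\lambda_H(B(V_0,\dots,V_{m-1}))$ where $\sum_i|V_i|=n$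 and $|V_i|=(a_i+o(1))n$. Equivalently, it is $\sum_f\prod_{i\in V(H)}a_{f(i)}$, the sum being over all maps $f:V(H)\to V(B)$ sending every red edge of $H$ to an edge of $B$ and every blue edge to a non-edge of $B$ or to two equal vertices. The edit distance $\delta_{\mathrm{edit}}(G,G')$ between two graphs of the same order is the minimum of $|f(E(G))\bigtriangleup E(G')|$ over all bijections $f:V(G)\to V(G')$. The semi-inducibility problem for $H$ is perfectly $B$-stable if there is $C>0$ such that for every graph $G$ of order $n\ge C$ there is a blowup $G'$ of $B$ of order $n$ with $\delta_{\mathrm{edit}}(G,G')\le C\,(\lambda_H(n)-\lambda_H(G))\,n^2$. (Here $C\ge\kappa$ may be assumed.) *)

(* Defs.v *)
From HB Require Import structures.
From mathcomp Require Import all_boot all_order all_algebra all_fingroup.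
From mathcomp Require Import all_classical all_reals all_analysis.

Set Implicit Arguments.
Unset Strict Implicit.
Unset Printing Implicit Defensive.

Import Order.TTheory GRing.Theory Num.Theory.
Import numFieldNormedType.Exports.

Local Open Scope ring_scope.

Record sgraph (T : finType) := SGraph {
  edges : {set {set T}};
  _ : [forall e in edges, #|e| == 2%N] }.

HB.instance Definition _ (T : finType) := [isSub for @edges T].
HB.instance Definition _ (T : finType) := [Finite of sgraph T by <:].

(* The pairs that are neither red nor blue are unconstrained. *)
Record cgraph (V : finType) := CGraph {
  red : {set {set V}};
  blue : {set {set V}};
  _ : [forall e in red :|: blue, #|e| == 2%N];
  _ : [disjoint red & blue] }.

(* Since f is injective, the image of a blue edge is a pair of distinct
   vertices, so "not in edges G" does mean "non-edge of G". *)
Definition is_embedding (V T : finType) (H : cgraph V) (G : sgraph T)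
    (f : {ffun V -> T}) : bool :=
  [&& injectiveb f,
      [forall e in red H, f @: e \in edges G]
    & [forall e in blue H, f @: e \notin edges G]].

Definition num_embeddings (V T : finType) (H : cgraph V) (G : sgraph T) : nat :=
  #|[set f : {ffun V -> T} | is_embedding H G f]|.

(* Junk value 0 when #|T| < #|V|. *)
Definition density (R : realType) (V T : finType) (H : cgraph V)
    (G : sgraph T) : R :=
  (num_embeddings H G)%:R / (#|T| ^_ #|V|)%:R.

(* Densities are non-negative and there is a graph of every order, so the
   default value 0 does not affect the maximum. *)
Definition max_density (R : realType) (V : finType) (H : cgraph V)
    (n : nat) : R :=
  \big[Num.max/0]_(G : sgraph 'I_n) density R H G.

Lemma blowup_subproof (U T : finType) (B : sgraph U) (p : {ffun T -> U}) :
  [forall e in [set e : {set T} | (#|e| == 2%N) && (p @: e \in edges B)],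
     #|e| == 2%N].
Proof. by apply/forall_inP => e; rewrite inE => /andP[]. Qed.

(* The blowup with parts V_i = p^-1(i), some possibly empty. *)
Definition blowup (U T : finType) (B : sgraph U) (p : {ffun T -> U}) :
  sgraph T := SGraph (blowup_subproof B p).

Definition in_simplex (R : realType) (m : nat) (a : 'rV[R]_m) : Prop :=
  (forall i, 0 <= a 0 i) /\ \sum_i a 0 i = 1.

Definition part_ratio (R : realType) (m n : nat) (p : {ffun 'I_n -> 'I_m})
    (i : 'I_m) : R :=
  #|[set x | p x == i]|%:R / n%:R.

Definition is_blowup_density (R : realType) (V : finType) (H : cgraph V)
    (m : nat) (B : sgraph 'I_m) (a : 'rV[R]_m) (l : R) : Prop :=
  forall p : forall n : nat, {ffun 'I_n -> 'I_m},
    (forall i : 'I_m, (part_ratio R (p n) i @[n --> \oo] --> a 0 i)%classic) ->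
    (density R H (blowup B (p n)) @[n --> \oo] --> l)%classic.

(* The limit exists and is unique for every a in the simplex. *)
Definition blowup_density (R : realType) (V : finType) (H : cgraph V)
    (m : nat) (B : sgraph 'I_m) (a : 'rV[R]_m) : R :=
  get (is_blowup_density H B a).

Definition is_maximizer (R : realType) (V : finType) (H : cgraph V)
    (m : nat) (B : sgraph 'I_m) (a : 'rV[R]_m) : Prop :=
  in_simplex a /\
  forall b : 'rV[R]_m, in_simplex b ->
    blowup_density H B b <= blowup_density H B a.

Definition edge_diff (T : finType) (G G' : sgraph T) (s : {perm T}) : nat :=
  let sG := [set [set s x | x in e] | e : {set T} in edges G] in
  #|(sG :\: edges G') :|: (edges G' :\: sG)|.

Definition edit_dist (T : finType) (G G' : sgraph T) : nat :=
  edge_diff G G' [arg min_(s < 1%g : {perm T}) edge_diff G G' s]%N.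

Definition perfectly_stable (R : realType) (V : finType) (H : cgraph V)
    (m : nat) (B : sgraph 'I_m) : Prop :=
  exists C : R, [/\ 0 < C, #|V|%:R <= C &
    forall (n : nat) (G : sgraph 'I_n), C <= n%:R ->
      exists p : {ffun 'I_n -> 'I_m},
        (edit_dist G (blowup B p))%:R
          <= C * (max_density R H n - density R H G) * n%:R ^+ 2].

Lemma complete_subproof (T : finType) :
  [forall e in [set e : {set T} | #|e| == 2%N], #|e| == 2%N].
Proof. by apply/forall_inP => e; rewrite inE. Qed.

Definition complete_graph (n : nat) : sgraph 'I_n :=
  SGraph (complete_subproof 'I_n).

Definition H_edge (i j : 'I_4) : {set 'I_4} := [set i; j].
Definition H_red : {set {set 'I_4}} := [set H_edge 0 1; H_edge 1 2].
Definition H_blue : {set {set 'I_4}} := [set H_edge 0 2; H_edge 0 3].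

Lemma H_subproof : [forall e in H_red :|: H_blue, #|e| == 2%N].
Proof.
apply/forall_inP => e; rewrite !inE.
by case/orP => /orP[] /eqP->; rewrite cards2.
Qed.

Lemma H_disjoint : [disjoint H_red & H_blue].
Proof.
rewrite disjoint_subset; apply/fintype.subsetP => e; rewrite !inE.
have ne (A B : {set 'I_4}) : 1 \in A -> 1 \notin B -> A != B.
  by move=> A1 B1; apply: contraNneq B1 => <-.
by case/orP => /eqP->; rewrite negb_or !ne ?inE.
Qed.

Definition H : cgraph 'I_4 := CGraph H_subproof H_disjoint.

(* Main.v *)
Require Import Defs.
From mathcomp Require Import all_boot all_order all_algebra all_fingroup.
From mathcomp Require Import all_classical all_reals all_analysis.
From mathcomp Require Import ring lra zify.
Import Order.TTheory GRing.Theory Num.Theory.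
Import numFieldNormedType.Exports.
Local Open Scope ring_scope.

(* An embedding of [H] amounts to an edge ab, a disjoint non-edge cd and a choice
   of one of c, d, say c, that is adjacent to exactly one of a and b. Hence
   2 Lambda is, up to lower order terms, the number of ordered pairs
   (edge, disjoint non-edge) minus a sum over triples with an odd number of
   edges ("bad" triples) weighted by the number of non-neighbours of a vertex.
   Exactly, if D is the number of ordered edges,
     2 Lambda = D (n^2 - 3 n + 4 - D) - defect,
   where the defect sums, over the vertices c, codegree-weighted counts of the
   bad triples {a, b, c} with ab an edge. It vanishes on bipartite blowups, so
   maximizing the quadratic in D gives 1/8 and the unique maximizer (1/2, 1/2).
   For stability, bad triples are exactly what the partition into N(c) and its
   complement gets wrong. Averaging over c with weight the codegree of c, the
   defect bounds n^2 times the distance from G to one of these complete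
   bipartite graphs, unless Sum_c deg(c) codeg(c) is so small that G is far from
   optimal. *)

(** * Local counts at a vertex and the exact formula for embeddings *)

Section Counts.
Context {R : realFieldType} {T : finType} (A : rel T).

Definition adj (x y : T) : R := (A x y)%:R.
Definition nadj (x y : T) : R := ((x != y) && ~~ A x y)%:R.

Definition deg (c : T) : R := \sum_x adj c x.
Definition codeg (c : T) : R := \sum_x nadj c x.

(* Adjacent pairs inside the neighbourhood of [c], inside its
   non-neighbourhood, and across; then non-adjacent pairs across. *)
Definition edges_in (c : T) : R :=
  \sum_x \sum_y adj c x * adj c y * adj x y.
Definition edges_out (c : T) : R :=
  \sum_x \sum_y nadj c x * nadj c y * adj x y.
Definition edges_cross (c : T) : R :=
  \sum_x \sum_y adj c x * nadj c y * adj x y.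
Definition nonedges_cross (c : T) : R :=
  \sum_x \sum_y adj c x * nadj c y * nadj x y.

Definition ord_edges : R := \sum_c deg c.
Definition num_emb : R := \sum_c (codeg c - 1) * edges_cross c.
Definition defect : R :=
  \sum_c ((codeg c - 2) * edges_in c + codeg c * edges_out c).

Lemma adj_ge0 x y : 0 <= adj x y. Proof. exact: ler0n. Qed.
Lemma nadj_ge0 x y : 0 <= nadj x y. Proof. exact: ler0n. Qed.
Lemma adj_le1 x y : adj x y <= 1. Proof. by rewrite /adj lern1; case: (A x y). Qed.

Lemma adj_nadj x y : adj x y * nadj x y = 0.
Proof. by rewrite /adj /nadj; case: (A x y); rewrite ?andbF /= ?mulr0 ?mul0r. Qed.

Hypotheses (Asym : symmetric A) (Airr : irreflexive A).

Lemma adjC x y : adj x y = adj y x. Proof. by rewrite /adj Asym. Qed.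
Lemma nadjC x y : nadj x y = nadj y x. Proof. by rewrite /nadj Asym eq_sym. Qed.

Lemma adj_total x y : (x == y)%:R + adj x y + nadj x y = 1.
Proof.
rewrite /adj /nadj; case: eqVneq => [->|_]; first by rewrite Airr /= !addr0.
by case: (A x y); rewrite /= ?addr0 ?add0r.
Qed.

Lemma sum_delta c (F : T -> R) : \sum_x (c == x)%:R * F x = F c.
Proof.
rewrite (bigD1 c) //= eqxx mul1r big1 ?addr0 // => x /negbTE xc.
by rewrite eq_sym xc mul0r.
Qed.

Lemma deg_codeg c : deg c + codeg c + 1 = #|T|%:R.
Proof.
rewrite -sum1_card natr_sum /deg /codeg -big_split /= -[X in _ + X](sum_delta c (fun=> 1)).
by rewrite -big_split /=; apply: eq_bigr => x _; rewrite mulr1 addrC addrA adj_total.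
Qed.

Lemma deg_ge0 c : 0 <= deg c.
Proof. by apply: sumr_ge0 => x _; apply: adj_ge0. Qed.
Lemma codeg_ge0 c : 0 <= codeg c.
Proof. by apply: sumr_ge0 => x _; apply: nadj_ge0. Qed.
Lemma edges_in_ge0 c : 0 <= edges_in c.
Proof. by do 2!(apply: sumr_ge0 => ? _); rewrite !mulr_ge0 ?adj_ge0 ?nadj_ge0. Qed.
Lemma edges_out_ge0 c : 0 <= edges_out c.
Proof. by do 2!(apply: sumr_ge0 => ? _); rewrite !mulr_ge0 ?adj_ge0 ?nadj_ge0. Qed.
Lemma edges_cross_ge0 c : 0 <= edges_cross c.
Proof. by do 2!(apply: sumr_ge0 => ? _); rewrite !mulr_ge0 ?adj_ge0 ?nadj_ge0. Qed.
Lemma nonedges_cross_ge0 c : 0 <= nonedges_cross c.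
Proof. by do 2!(apply: sumr_ge0 => ? _); rewrite !mulr_ge0 ?adj_ge0 ?nadj_ge0. Qed.

Lemma sum2D (F1 F2 : T -> T -> R) :
  \sum_x \sum_y (F1 x y + F2 x y) =
  \sum_x \sum_y F1 x y + \sum_x \sum_y F2 x y.
Proof. by rewrite -big_split; apply: eq_bigr => x _; rewrite big_split. Qed.

Lemma sum2M (f g : T -> R) :
  \sum_x \sum_y f x * g y = (\sum_x f x) * (\sum_y g y).
Proof. by rewrite mulr_suml; apply: eq_bigr => x _; rewrite mulr_sumr. Qed.

Lemma sum_split c (F : T -> R) :
  \sum_x F x = F c + \sum_x adj c x * F x + \sum_x nadj c x * F x.
Proof.
rewrite -[X in X + _ + _](sum_delta c) -!big_split /=; apply: eq_bigr => x _.
by rewrite -!mulrDl adj_total mul1r.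
Qed.

(** The ordered edges are sorted by where their ends lie: at [c], among its neighbours, or among its
    non-neighbours. *)
Lemma ord_edges_split c :
  ord_edges = deg c *+ 2 + edges_cross c *+ 2 + edges_in c + edges_out c.
Proof.
rewrite /ord_edges (sum_split c).
have nadjM0 : \sum_x nadj c x * adj x c = 0.
  by rewrite big1 // => x _; rewrite adjC mulrC adj_nadj.
have adjM : \sum_x adj c x * adj x c = deg c.
  apply: eq_bigr => x _.
  by rewrite (adjC x c) /adj; case: (A c x); rewrite ?mulr0 ?mulr1.
have -> : \sum_x adj c x * deg x = deg c + edges_in c + edges_cross c.
  rewrite -adjM /edges_in /edges_cross -!big_split; apply: eq_bigr => x _ /=.
  rewrite /deg (sum_split c) !mulrDr !mulr_sumr.
  by congr (_ + _ + _); apply: eq_bigr => y _; ring.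
have -> : \sum_x nadj c x * deg x = edges_cross c + edges_out c.
  have -> : edges_cross c = \sum_x \sum_y nadj c x * adj c y * adj x y.
    rewrite /edges_cross exchange_big; apply: eq_bigr => x _; apply: eq_bigr => y _.
    by rewrite (adjC y x); ring.
  rewrite -[RHS]add0r -[X in X + _]nadjM0 addrA /edges_out -!big_split.
  apply: eq_bigr => x _ /=.
  rewrite /deg (sum_split c) !mulrDr !mulr_sumr.
  by congr (_ + _ + _); apply: eq_bigr => y _; ring.
by ring.
Qed.

Lemma deg_mul_codeg c : deg c * codeg c = edges_cross c + nonedges_cross c.
Proof.
rewrite -sum2M -sum2D; apply: eq_bigr => x _; apply: eq_bigr => y _.
rewrite -mulrDr; case: (eqVneq x y) => [<-|xy].
  by rewrite adj_nadj mul0r.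
have := adj_total x y; rewrite (negbTE xy) add0r => ->.
by rewrite mulr1.
Qed.

(** Both sides count ordered triples spanning exactly one edge, seen from an end of that edge on the
    left and from the third vertex on the right. *)
Lemma sum_nonedges_cross : \sum_c nonedges_cross c = \sum_c edges_out c.
Proof.
rewrite /nonedges_cross /edges_out.
under eq_bigr do rewrite exchange_big.
rewrite exchange_big; apply: eq_bigr => c _; apply: eq_bigr => x _.
apply: eq_bigr => y _ /=.
by rewrite (nadjC x c) (nadjC y c); ring.
Qed.

Lemma num_emb_defect :
  num_emb *+ 2 =
  ord_edges * (#|T|%:R ^+ 2 - #|T|%:R *+ 3 + 4 - ord_edges) - defect.
Proof.
set n : R := #|T|%:R; set D := ord_edges.
suff : num_emb *+ 2 + defect = D * (n ^+ 2 - n *+ 3 + 4 - D).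
  by move=> <-; rewrite addrK.
(* The equality holds vertex by vertex, by eliminating [codeg c] and using the two local identities;
   the last term cancels only after summation, by [sum_nonedges_cross]. *)
transitivity (\sum_c (D * (n - 3) + (4 - D) * deg c +
                      2 * (edges_out c - nonedges_cross c))).
  rewrite mulr2n /num_emb /defect -!big_split; apply: eq_bigr => c _ /=.
  have := ord_edges_split c; rewrite -/D; have := deg_mul_codeg c.
  have -> : codeg c = n - 1 - deg c by rewrite /n -(deg_codeg c); ring.
  by nra.
rewrite !big_split /= sumr_const -!mulr_sumr sumrB sum_nonedges_cross subrr.
by rewrite mulr0 addr0 -/ord_edges -/D -mulr_natl -/n; ring.
Qed.

(** * Bounds on the local counts *)

Lemma codeg_natE c : exists k : nat, codeg c = k%:R.
Proof. by exists (\sum_x ((c != x) && ~~ A c x))%N; rewrite natr_sum. Qed.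

Lemma sum2_le (F1 F2 : T -> T -> R) :
  (forall x y, F1 x y <= F2 x y) ->
  \sum_x \sum_y F1 x y <= \sum_x \sum_y F2 x y.
Proof. by move=> F12; do 2!(apply: ler_sum => ? _). Qed.

Lemma edges_cross_le c : edges_cross c <= deg c * codeg c.
Proof. by rewrite deg_mul_codeg lerDl nonedges_cross_ge0. Qed.

Lemma edges_in_le c : edges_in c <= deg c * deg c.
Proof.
rewrite -sum2M; apply: sum2_le => x y.
by rewrite ler_piMr ?adj_le1 // mulr_ge0 ?adj_ge0.
Qed.

Lemma edges_out_le c : edges_out c <= codeg c * (codeg c - 1).
Proof.
rewrite mulrBr mulr1 -sum2M lerBrDr.
(* The diagonal pairs are never edges, which improves the bound by [codeg c]. *)
have -> : codeg c = \sum_x \sum_y nadj c x * nadj c y * (x == y)%:R.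
  apply: eq_bigr => x _; rewrite (bigD1 x) //= eqxx big1 ?addr0 => [|y].
    by rewrite mulr1 /nadj; case: (_ && _); rewrite ?mulr0 ?mulr1.
  by rewrite eq_sym => /negbTE ->; rewrite mulr0.
rewrite -sum2D; apply: sum2_le => x y.
rewrite -mulrDr ler_piMr ?mulr_ge0 ?nadj_ge0 //.
by have := adj_total x y; have := nadj_ge0 x y; lra.
Qed.

(** The first factor can be negative only if [codeg c] is 0 or 1, by integrality, and then no edge
    joins two non-neighbours of [c]. *)
Lemma codeg_edges_out_ge0 c : 0 <= (codeg c - 2) * edges_out c.
Proof.
have := edges_out_le c; have := edges_out_ge0 c.
have [[|[|k]] ->] := codeg_natE c; [nra|nra|move=> E0 _].
by rewrite mulr_ge0 // subr_ge0 ler_nat.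
Qed.

(** An edge not inside the neighbourhood meets [c] or one of its non-neighbours, and each vertex
    lies on at most 2n ordered edges. *)
Lemma edges_in_ge c : ord_edges - (codeg c + 1) * #|T|%:R *+ 2 <= edges_in c.
Proof.
have := ord_edges_split c; have := edges_cross_le c; have := edges_out_le c.
have := deg_ge0 c; have := codeg_ge0 c; rewrite -(deg_codeg c); nra.
Qed.

(** Shows that a graph with a small sum on the right is far from optimal. *)
Lemma num_emb_le : num_emb <= #|T|%:R * \sum_c deg c * codeg c.
Proof.
rewrite mulr_sumr; apply: ler_sum => c _.
have := edges_cross_le c; have := edges_cross_ge0 c.
have := deg_ge0 c; have := codeg_ge0 c; rewrite -(deg_codeg c).
move=> r0 d0 e0 eler; apply: (@le_trans _ _ (codeg c * edges_cross c)).
  by apply: ler_wpM2r => //; lra.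
by apply: ler_pM => //; lra.
Qed.

Lemma sum_edges_in_le : \sum_c edges_in c <= #|T|%:R ^+ 3.
Proof.
apply: (@le_trans _ _ (\sum_(c : T) #|T|%:R ^+ 2)).
  apply: ler_sum => c _; apply: (le_trans (edges_in_le c)).
  have := deg_ge0 c; have := codeg_ge0 c; rewrite -(deg_codeg c); nra.
by rewrite sumr_const -[leLHS]mulr_natl -exprS.
Qed.

(* [defect] with the triangle terms put back; unlike [defect] it is a sum of
   non-negative terms. *)
Definition surplus : R :=
  \sum_c (codeg c * edges_in c + (codeg c - 2) * edges_out c).

Lemma surplus_ge0 : 0 <= surplus.
Proof.
apply: sumr_ge0 => c _.
by rewrite addr_ge0 ?codeg_edges_out_ge0 // mulr_ge0 ?codeg_ge0 ?edges_in_ge0.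
Qed.

Lemma defect_surplus :
  defect = surplus - (\sum_c edges_in c) *+ 2 + (\sum_c edges_out c) *+ 2.
Proof.
rewrite /defect /surplus -!sumrMnl -sumrN -!big_split /=.
by apply: eq_bigr => c _; ring.
Qed.

Lemma sum_codeg_in_le : \sum_c codeg c * edges_in c <= surplus.
Proof. by apply: ler_sum => c _; rewrite lerDl codeg_edges_out_ge0. Qed.

Lemma sum_edges_out_ge0 : 0 <= \sum_c edges_out c.
Proof. by apply: sumr_ge0 => c _; apply: edges_out_ge0. Qed.

(** Only the triangle terms can make the defect negative, and they are of order n^3, negligible
    against n^4. *)
Lemma num_emb_upper :
  num_emb *+ 2 <=
  ord_edges * (#|T|%:R ^+ 2 - #|T|%:R *+ 3 + 4 - ord_edges) + #|T|%:R ^+ 3 *+ 2.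
Proof.
rewrite num_emb_defect defect_surplus.
have := surplus_ge0; have := sum_edges_in_le; have := sum_edges_out_ge0; lra.
Qed.

(** * From the defect to the distance to a complete bipartite graph *)

(** If [codeg c] is at least n/80, then [codeg c - 2] is at least n/160. Otherwise almost all edges
    lie inside the neighbourhood, and the term with [edges_in c] dominates, since [edges_out c] is
    at most the square of [codeg c]. *)
Lemma edges_out_surplus c :
  320 <= #|T|%:R :> R -> #|T|%:R ^+ 2 / 10 <= ord_edges ->
  #|T|%:R * edges_out c <=
  160 * (codeg c * edges_in c + (codeg c - 2) * edges_out c).
Proof.
set n : R := #|T|%:R => n_ge D_ge.
have r0 := codeg_ge0 c; have I0 := edges_in_ge0 c; have E0 := edges_out_ge0 c.
have d0 := deg_ge0 c; have rE := codeg_edges_out_ge0 c.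
have nE := deg_codeg c; rewrite -/n in nE.
have Ile := edges_in_ge c; rewrite -/n in Ile.
have [rbig|rsmall] := lerP (n / 80) (codeg c).
  have rI : 0 <= codeg c * edges_in c by rewrite mulr_ge0.
  have : n * edges_out c <= 160 * (codeg c - 2) * edges_out c.
    by apply: ler_wpM2r => //; lra.
  lra.
have Ege : n ^+ 2 / 20 <= edges_in c.
  have : (codeg c + 1) * n <= (n / 80 + 1) * n by apply: ler_wpM2r; lra.
  have : 320 * n <= n * n by apply: ler_wpM2r; lra.
  rewrite expr2 in D_ge *; lra.
have : edges_out c <= codeg c * codeg c.
  by apply: (le_trans (edges_out_le c)); apply: ler_wpM2l => //; lra.
have : codeg c * codeg c <= codeg c * (n / 80) by apply: ler_wpM2l => //; lra.
have : codeg c * (n ^+ 2 / 20) <= codeg c * edges_in c by apply: ler_wpM2l.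
move=> h1 h2 h3.
have : n * edges_out c <= n * (codeg c * (n / 80)).
  by apply: ler_wpM2l; lra.
rewrite expr2 in h1; have : 0 <= codeg c * n * n by rewrite !mulr_ge0 //; lra.
lra.
Qed.

(* Triangles through [c], weighted by the codegrees of the other two vertices. *)
Definition tri_codeg (c : T) : R :=
  \sum_x \sum_y adj c x * adj c y * adj x y * (codeg x + codeg y).

(** Each vertex of a triangle is weighted once from each of the two others. *)
Lemma sum_tri_codeg :
  \sum_c tri_codeg c = (\sum_c codeg c * edges_in c) *+ 2.
Proof.
have half : \sum_c \sum_x \sum_y adj c x * adj c y * adj x y * codeg x =
    \sum_c codeg c * edges_in c.
  rewrite exchange_big; apply: eq_bigr => x _.
  rewrite mulr_sumr; apply: eq_bigr => c _; rewrite mulr_sumr.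
  by apply: eq_bigr => y _; rewrite (adjC c x); ring.
rewrite -half -sumrMnl; apply: eq_bigr => c _.
rewrite mulr2n [X in _ = _ + X]exchange_big /= -sum2D.
apply: eq_bigr => x _; apply: eq_bigr => y _.
by rewrite (adjC y x); ring.
Qed.

(** The doubled sum weights every edge by the codegrees of its two ends. Passing to the edges inside
    the neighbourhood of [c] loses at most 2n for each of the at most 2([codeg c] + 1)n others. *)
Lemma tri_codeg_ge c :
  (\sum_x deg x * codeg x) *+ 2 - (codeg c + 1) * #|T|%:R ^+ 2 *+ 4 <=
  tri_codeg c.
Proof.
set n : R := #|T|%:R.
have codeg_len x : codeg x <= n.
  by have := deg_ge0 x; rewrite /n -(deg_codeg x); lra.
have -> : (\sum_x deg x * codeg x) *+ 2 =
    \sum_x \sum_y adj x y * (codeg x + codeg y).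
  rewrite mulr2n.
  have half : \sum_x deg x * codeg x = \sum_x \sum_y adj x y * codeg x.
    by apply: eq_bigr => x _; rewrite mulr_suml.
  rewrite half {2}exchange_big /= -sum2D; apply: eq_bigr => x _.
  by apply: eq_bigr => y _; rewrite (adjC y x); ring.
have : \sum_x \sum_y (adj x y * (codeg x + codeg y) +
    adj c x * adj c y * adj x y * (2 * n)) <=
    \sum_x \sum_y (adj c x * adj c y * adj x y * (codeg x + codeg y) +
    adj x y * (2 * n)).
  apply: sum2_le => x y.
  have : adj c x * adj c y <= 1.
    by rewrite mulr_ile1 ?adj_ge0 ?adj_le1.
  have := adj_ge0 x y; have := codeg_len x; have := codeg_len y.
  move=> hx hy a0 a1.
  have : 0 <= adj x y * (1 - adj c x * adj c y) * (2 * n - codeg x - codeg y).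
    by rewrite !mulr_ge0 //; lra.
  lra.
rewrite !sum2D.
have -> : \sum_x \sum_y adj c x * adj c y * adj x y * (2 * n) =
    edges_in c * (2 * n).
  by rewrite mulr_suml; apply: eq_bigr => x _; rewrite mulr_suml.
have -> : \sum_x \sum_y adj x y * (2 * n) = ord_edges * (2 * n).
  by rewrite mulr_suml; apply: eq_bigr => x _; rewrite mulr_suml.
have : (ord_edges - edges_in c) * n <= (codeg c + 1) * n *+ 2 * n.
  by apply: ler_wpM2r => //; have := edges_in_ge c; rewrite -/n; lra.
rewrite -/(tri_codeg c) expr2; lra.
Qed.

(** The first term suffices when [codeg c] is at least 10. Otherwise [c] sees almost the whole
    graph, so [tri_codeg c] is at least n^3/10, while [edges_in c] is at most n^2. *)
Lemma edges_in_tri_codeg c :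
  440 <= #|T|%:R :> R -> #|T|%:R ^+ 3 / 10 <= \sum_x deg x * codeg x ->
  #|T|%:R * edges_in c <=
  #|T|%:R / 10 * (codeg c * edges_in c) + 10 * tri_codeg c.
Proof.
set n : R := #|T|%:R => n_ge Q_ge.
have r0 := codeg_ge0 c; have I0 := edges_in_ge0 c; have d0 := deg_ge0 c.
have nE := deg_codeg c; rewrite -/n in nE.
have Y0 : 0 <= tri_codeg c.
  do 2!(apply: sumr_ge0 => ? _).
  by rewrite !mulr_ge0 ?addr_ge0 ?codeg_ge0 ?adj_ge0.
have [rbig|rsmall] := lerP 10 (codeg c).
  have : 10 * (n * edges_in c) <= codeg c * (n * edges_in c).
    by apply: ler_wpM2r => //; rewrite mulr_ge0.
  lra.
have Yge : n ^+ 3 / 10 <= tri_codeg c.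
  apply: le_trans (tri_codeg_ge c); rewrite -/n.
  have : (codeg c + 1) * n ^+ 2 <= 11 * n ^+ 2.
    by apply: ler_wpM2r; [rewrite sqr_ge0|lra].
  have : 440 * n ^+ 2 <= n * n ^+ 2 by apply: ler_wpM2r; rewrite ?sqr_ge0.
  rewrite -exprS; lra.
have Ile : edges_in c <= n * n.
  apply: (le_trans (edges_in_le c)); apply: ler_pM => //; lra.
have : n * edges_in c <= n * (n * n) by apply: ler_wpM2l => //; lra.
have : 0 <= n * (codeg c * edges_in c) by rewrite !mulr_ge0 //; lra.
rewrite exprSr expr2 in Yge; lra.
Qed.

(** Summing the previous bound gives the factor 1/10 + 20/n, which is at most 1/8 for n at least
    800. So the triangle terms cost [defect] at most a quarter of [surplus]. *)
Lemma sum_edges_in_surplus :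
  800 <= #|T|%:R :> R -> #|T|%:R ^+ 3 / 10 <= \sum_x deg x * codeg x ->
  \sum_c edges_in c <= surplus / 8.
Proof.
set n : R := #|T|%:R => n_ge Q_ge.
set S := \sum_c codeg c * edges_in c.
have S0 : 0 <= S.
  by apply: sumr_ge0 => c _; rewrite mulr_ge0 ?codeg_ge0 ?edges_in_ge0.
have SZ : S <= surplus by exact: sum_codeg_in_le.
have nI : n * \sum_c edges_in c <= n / 10 * S + 20 * S.
  have -> : 20 * S = 10 * (S *+ 2) by ring.
  rewrite -sum_tri_codeg /S !mulr_sumr -big_split.
  by apply: ler_sum => c _; apply: edges_in_tri_codeg => //; rewrite -/n; lra.
have n0 : 0 < n by lra.
rewrite -(ler_pM2l n0); apply: (le_trans nI).
have : 800 * S <= n * S by apply: ler_wpM2r.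
have : n * S <= n * surplus by apply: ler_wpM2l => //; lra.
lra.
Qed.

Lemma defect_ge :
  800 <= #|T|%:R :> R -> #|T|%:R ^+ 3 / 10 <= \sum_x deg x * codeg x ->
  3 / 4 * surplus <= defect.
Proof.
move=> n_ge Q_ge; rewrite defect_surplus.
have := sum_edges_in_surplus n_ge Q_ge; have := sum_edges_out_ge0; lra.
Qed.

(* The number of ordered pairs on which the graph differs from the complete
   bipartite graph with parts [N(c)] and its complement. *)
Definition mismatch (c : T) : R :=
  \sum_x \sum_y (A x y != (A c x != A c y))%:R.

Lemma mismatch_le c :
  mismatch c <= edges_in c + edges_out c + nonedges_cross c *+ 2.
Proof.
have -> : edges_in c + edges_out c + nonedges_cross c *+ 2 =
    \sum_x \sum_y (adj c x * adj c y * adj x y + nadj c x * nadj c y * adj x y +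
     adj c x * nadj c y * nadj x y + nadj c x * adj c y * nadj x y).
  rewrite !sum2D mulr2n addrA; congr (_ + _).
  rewrite exchange_big; apply: eq_bigr => x _; apply: eq_bigr => y _ /=.
  by rewrite (nadjC x y); ring.
apply: sum2_le => x y; rewrite /adj /nadj.
case: (eqVneq c x) => [<-|cx]; rewrite ?Airr.
  case: (eqVneq c y) => [<-|cy]; rewrite ?Airr //= ?mulr0 ?mul0r ?addr0 //.
  by case: (A c y); rewrite /= ?mulr0 ?mul0r ?addr0.
case: (eqVneq c y) => [<-|cy]; rewrite ?Airr ?(Asym x c) /=.
  by case: (A c x); rewrite /= ?mulr0 ?mul0r ?addr0.
case: (eqVneq x y) => [<-|xy]; rewrite ?Airr /=.
  by case: (A c x); rewrite /= ?mulr0 ?mul0r ?addr0.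
by case: (A c x); case: (A c y); case: (A x y);
  rewrite /= ?mulr0 ?mul0r ?addr0 ?add0r ?mulr1.
Qed.

(** The constant is 1 + 160 + 2 * 160, for the edges inside, the edges outside and the two orders of
    the non-edges across. *)
Lemma sum_codeg_mismatch :
  320 <= #|T|%:R :> R -> #|T|%:R ^+ 2 / 10 <= ord_edges ->
  \sum_c codeg c * mismatch c <= 481 * surplus.
Proof.
set n : R := #|T|%:R => n_ge D_ge.
have codeg_len x : codeg x <= n.
  by have := deg_ge0 x; rewrite /n -(deg_codeg x); lra.
have nE : n * \sum_c edges_out c <= 160 * surplus.
  by rewrite !mulr_sumr; apply: ler_sum => c _; apply: edges_out_surplus.
have rX : \sum_c codeg c * nonedges_cross c <= n * \sum_c edges_out c.
  rewrite -sum_nonedges_cross mulr_sumr; apply: ler_sum => c _.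
  by rewrite ler_wpM2r ?nonedges_cross_ge0.
have rE : \sum_c codeg c * edges_out c <= n * \sum_c edges_out c.
  rewrite mulr_sumr; apply: ler_sum => c _.
  by rewrite ler_wpM2r ?edges_out_ge0.
have rI := sum_codeg_in_le.
apply: (@le_trans _ _ (\sum_c (codeg c * edges_in c + codeg c * edges_out c +
    codeg c * nonedges_cross c + codeg c * nonedges_cross c))).
  apply: ler_sum => c _; rewrite -!mulrDr ler_wpM2l ?codeg_ge0 //.
  by have := mismatch_le c; lra.
rewrite !big_split /=; lra.
Qed.

(* Kept folded: comparing two copies of this numeral over different structures
   on [R] would unfold it in unary. *)
Definition stab_const : R := 6500.

Lemma sum_gt0 (F : T -> R) c : (forall x, 0 <= F x) -> 0 < F c -> 0 < \sum_x F x.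
Proof.
move=> F0 Fc; rewrite (bigD1 c) //= ltr_pwDl //.
by apply: sumr_ge0 => x _.
Qed.

(** If every vertex failed, the average weighted by [codeg] would fail too. The weights sum to at
    least n^2/10 and [defect] is at least 3/4 of [surplus], so a contradiction needs 6500 * 3/40 >
    481. *)
Lemma exists_mismatch_le :
  800 <= #|T|%:R :> R -> #|T|%:R ^+ 3 / 10 <= \sum_x deg x * codeg x ->
  exists c, #|T|%:R ^+ 2 * mismatch c <= stab_const * defect.
Proof.
rewrite /stab_const.
set n : R := #|T|%:R => n_ge Q_ge.
have codeg_len x : codeg x <= n.
  by have := deg_ge0 x; rewrite /n -(deg_codeg x); lra.
have deg_len x : deg x <= n.
  by have := codeg_ge0 x; rewrite /n -(deg_codeg x); lra.
have n0 : 0 < n by lra.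
have D_ge : n ^+ 2 / 10 <= ord_edges.
  rewrite -(ler_pM2l n0) mulrA -exprS; apply: (le_trans Q_ge).
  rewrite mulr_sumr; apply: ler_sum => c _.
  by rewrite mulrC ler_wpM2r ?deg_ge0.
have N_ge : n ^+ 2 / 10 <= \sum_c codeg c.
  rewrite -(ler_pM2l n0) mulrA -exprS; apply: (le_trans Q_ge).
  rewrite mulr_sumr; apply: ler_sum => c _.
  by rewrite ler_wpM2r ?codeg_ge0.
have n_ge' : 320 <= n by lra.
have avg := sum_codeg_mismatch n_ge' D_ge.
have := defect_ge n_ge Q_ge; have Z0 := surplus_ge0.
move: defect => def dZ.
case: (pselect (exists c, n ^+ 2 * mismatch c <= 6500 * def)) => // /forallNP big.
have {}big c : 0 < n ^+ 2 * mismatch c - 6500 * def.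
  by have /negP := big c; rewrite -ltNge subr_gt0.
have [c0 r0] : exists c, 0 < codeg c.
  apply: contrapT => /forallNP r_le0.
  have : \sum_c codeg c <= 0.
    by apply: sumr_le0 => c _; rewrite leNgt; apply/negP/r_le0.
  by have n20 : 0 < n ^+ 2 := exprn_gt0 2 n0; lra.
have := sum_gt0 _ c0 (fun c => mulr_ge0 (codeg_ge0 c) (ltW (big c)))
  (mulr_gt0 r0 (big c0)).
have -> : \sum_c codeg c * (n ^+ 2 * mismatch c - 6500 * def) =
    n ^+ 2 * (\sum_c codeg c * mismatch c) - 6500 * (def * \sum_c codeg c).
  rewrite !mulr_sumr -sumrB; apply: eq_bigr => c _.
  ring.
have : n ^+ 2 * (\sum_c codeg c * mismatch c) <= n ^+ 2 * (481 * surplus).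
  by rewrite ler_wpM2l ?sqr_ge0.
have : 3 / 4 * surplus * (n ^+ 2 / 10) <= def * \sum_c codeg c.
  by apply: ler_pM => //; rewrite ?divr_ge0 ?sqr_ge0 ?mulr_ge0 //; lra.
have : 0 <= n ^+ 2 * surplus by rewrite mulr_ge0 ?sqr_ge0.
move: (n ^+ 2) surplus (def * _) (\sum_c _ * mismatch c) => N2 Z X Y.
clear; lra.
Qed.
End Counts.

(** * Complete bipartite graphs *)

Section Bipartite.
Context {R : realFieldType} {T : finType} (q : T -> bool).

Definition bip : rel T := fun x y => q x != q y.
Definition part_card : R := \sum_x (q x)%:R.

Lemma bip_sym : symmetric bip.
Proof. by move=> x y; rewrite /bip eq_sym. Qed.

Lemma bip_irr : irreflexive bip.
Proof. by move=> x; rewrite /bip eqxx. Qed.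

Lemma ord_edges_bip :
  ord_edges bip = (part_card * (#|T|%:R - part_card)) *+ 2 :> R.
Proof.
have -> : #|T|%:R - part_card = \sum_x (~~ q x)%:R.
  rewrite -sum1_card natr_sum /part_card -sumrB; apply: eq_bigr => x _.
  by case: (q x); rewrite ?subrr ?subr0.
rewrite mulr2n -{1}sum2M mulrC -sum2M -sum2D.
apply: eq_bigr => x _; apply: eq_bigr => y _; rewrite /adj /bip.
by case: (q x); case: (q y); rewrite /= ?mulr0 ?mul0r ?mulr1 ?addr0 ?add0r.
Qed.

(** There are no triangles, and the non-neighbours of a vertex lie in its own part. *)
Lemma defect_bip : defect bip = 0 :> R.
Proof.
rewrite /defect big1 // => c _.
have -> : edges_in bip c = 0 :> R.
  rewrite /edges_in big1 // => x _; rewrite big1 // => y _; rewrite /adj /bip.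
  by case: (q c); case: (q x); case: (q y); rewrite /= ?mulr0 ?mul0r.
have -> : edges_out bip c = 0 :> R.
  rewrite /edges_out big1 // => x _; rewrite big1 // => y _.
  rewrite /adj /nadj /bip.
  by case: (q c); case: (q x); case: (q y); rewrite /= ?andbF ?mulr0 ?mul0r.
by rewrite !mulr0 addr0.
Qed.

Lemma num_emb_bip :
  num_emb bip *+ 2 = ord_edges bip *
    (#|T|%:R ^+ 2 - #|T|%:R *+ 3 + 4 - ord_edges bip) :> R.
Proof. by rewrite (num_emb_defect bip bip_sym bip_irr) defect_bip subr0. Qed.

End Bipartite.

Lemma ord_edges_mismatch (R : realFieldType) (T : finType) (A : rel T) (c : T) :
  `|ord_edges A - ord_edges (bip (A c))| <= mismatch A c :> R.
Proof.
rewrite /ord_edges -sumrB (le_trans (ler_norm_sum _ _ _)) //.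
apply: ler_sum => x _; rewrite /deg -sumrB (le_trans (ler_norm_sum _ _ _)) //.
apply: ler_sum => y _; rewrite /adj /bip.
by case: (A x y); case: (_ != _);
  rewrite /= ?subrr ?subr0 ?sub0r ?normrN ?normr0 ?normr1.
Qed.

(** * From edge sets to adjacency relations *)

Section Graphs.
Context {T : finType}.
Implicit Types (G : sgraph T) (p : {ffun T -> 'I_2}).

Definition gadj G : rel T := fun x y => [set x; y] \in edges G.

Lemma edges_card2 G e : e \in edges G -> #|e| = 2%N.
Proof. by case: G => E /= /forall_inP E2 /E2/eqP. Qed.

Lemma gadj_sym G : symmetric (gadj G).
Proof. by move=> x y; rewrite /gadj finset.setUC. Qed.

Lemma gadj_irr G : irreflexive (gadj G).
Proof.
by move=> x; apply/negP => /edges_card2; rewrite finset.setUid cards1.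
Qed.

Lemma gadj_blowup p :
  gadj (blowup (complete_graph 2) p) = bip (fun x => p x == 0).
Proof.
apply/funext => x; apply/funext => y.
rewrite /gadj /bip /= !inE imsetU1 imset_set1 !cards2 !eqSS !eqb1.
have -> : (p x != p y) = ((p x == 0) != (p y == 0)).
  by case: (p x) => [[|[|?]] ?]; case: (p y) => [[|[|?]] ?].
by have [->|] := eqVneq x y; rewrite ?eqxx.
Qed.

Lemma card_edges_le (R : realFieldType) (W : {set {set T}}) :
  (forall e, e \in W -> #|e| = 2%N) ->
  #|W|%:R <= \sum_x \sum_y ([set x; y] \in W)%:R :> R.
Proof.
move=> W2; pose P := [set u : T * T | [set u.1; u.2] \in W].
have -> : \sum_x \sum_y ([set x; y] \in W)%:R = #|P|%:R :> R.
  rewrite pair_bigA /= -sum1_card natr_sum [RHS]big_mkcond /=.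
  by apply: eq_bigr => u _; rewrite inE; case: (_ \in W).
rewrite ler_nat; apply: leq_trans (leq_imset_card (fun u => [set u.1; u.2]) P).
apply: subset_leq_card; apply/fintype.subsetP => e eW.
have /eqP/cards2P[x [y [_ eE]]] := W2 e eW.
by apply/imsetP; exists (x, y); rewrite ?inE -?eE.
Qed.

Lemma edit_dist_le (R : realFieldType) G p :
  (edit_dist G (blowup (complete_graph 2) p))%:R <=
  \sum_x \sum_y (gadj G x y != ((p x == 0) != (p y == 0)))%:R :> R.
Proof.
set G' := blowup _ p.
(* The identity permutation is enough, as the partition is defined on the vertices of [G]. *)
have : (edit_dist G G' <= edge_diff G G' 1%g)%N.
  by rewrite /edit_dist; case: arg_minnP => // s _ /(_ 1%g isT).
rewrite -(ler_nat R) => /le_trans; apply.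
rewrite /edge_diff.
have -> : [set [set (1%g : {perm T}) x | x in e] | e : {set T} in edges G] = edges G.
  rewrite -[RHS]imset_id; apply: eq_imset => e.
  by rewrite -[RHS]imset_id; apply: eq_imset => x; rewrite perm1.
apply: (le_trans (card_edges_le R _ _)) => [e|].
  by rewrite finset.in_setU !finset.in_setD => /orP[] /andP[_]; apply: edges_card2.
apply: sum2_le => x y; rewrite ler_nat finset.in_setU !finset.in_setD.
have := congr1 (fun r : rel T => r x y) (gadj_blowup p).
rewrite /gadj /bip -/G' => <-.
by case: (_ \in edges G); case: (_ \in edges G').
Qed.

Definition quad_ffun (u : T * T * T * T) : {ffun 'I_4 -> T} :=
  let: (a, b, c, d) := u in [ffun i : 'I_4 => nth a [:: a; b; c; d] i].

Lemma quad_ffun_bij : bijective quad_ffun.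
Proof.
exists (fun f : {ffun 'I_4 -> T} => (f 0, f 1, f 2, f 3)).
  by move=> [[[a b] c] d]; rewrite /quad_ffun !ffunE.
move=> f; apply/ffunP; case=> [[|[|[|[|//]]]] ?]; rewrite /quad_ffun !ffunE /=;
  by congr (f _); apply: val_inj.
Qed.

(** The remaining distinctness is automatic: adjacent vertices differ, and b differs from d because
    a is adjacent to b but not to d. *)
Lemma is_embedding_quad G a b c d :
  is_embedding H G (quad_ffun (a, b, c, d)) =
  [&& gadj G a b, gadj G b c, (a != c) && ~~ gadj G a c,
      (a != d) && ~~ gadj G a d & c != d].
Proof.
set f := quad_ffun _.
have f0 : f 0 = a by rewrite !ffunE.
have f1 : f 1 = b by rewrite !ffunE.
have f2 : f 2 = c by rewrite !ffunE.
have f3 : f 3 = d by rewrite !ffunE.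
have edgeE i j : (f @: H_edge i j \in edges G) = gadj G (f i) (f j).
  by rewrite /H_edge imsetU1 imset_set1.
apply/idP/idP.
  case/and3P => /injectiveP f_inj /forall_inP fr /forall_inP fb.
  have := fr (H_edge 0 1); have := fr (H_edge 1 2).
  have := fb (H_edge 0 2); have := fb (H_edge 0 3).
  rewrite !inE !eqxx ?orbT /= !edgeE f0 f1 f2 f3.
  do 4!move=> /(_ isT) ->.
  by rewrite -f0 -f2 -f3 !(inj_eq f_inj).
case/and5P => ab bc /andP[a'c ac] /andP[a'd ad] c'd.
have a'b : a != b by apply: contraTneq ab => ->; rewrite gadj_irr.
have b'c : b != c by apply: contraTneq bc => ->; rewrite gadj_irr.
have b'd : b != d by apply: contraNneq ad => <-.
apply/and3P; split.
- apply/injectiveP => i j; rewrite /f /quad_ffun !ffunE.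
  case: i => [[|[|[|[|//]]]] ?]; case: j => [[|[|[|[|//]]]] ?] //=; move=> E;
  first [exact: val_inj | by move: a'b a'c a'd b'c b'd c'd; rewrite E ?eqxx].
- by apply/forall_inP => e; rewrite !inE => /orP[] /eqP ->; rewrite edgeE ?f0 ?f1 ?f2.
- by apply/forall_inP => e; rewrite !inE => /orP[] /eqP ->; rewrite edgeE ?f0 ?f2 ?f3.
Qed.

Lemma num_embeddingsE (R : realFieldType) G :
  (num_embeddings H G)%:R = num_emb (gadj G) :> R.
Proof.
rewrite /num_embeddings -sum1_card natr_sum big_mkcond /=.
rewrite (reindex quad_ffun) /=; last exact: onW_bij quad_ffun_bij.
pose F a b c d : R := adj (gadj G) a b * nadj (gadj G) a c * adj (gadj G) b c *
  (nadj (gadj G) a d * (c != d)%:R).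
transitivity (\sum_a \sum_b \sum_c \sum_d F a b c d).
  rewrite (pair_bigA _ (fun a b => \sum_c \sum_d F a b c d)) /=.
  rewrite (pair_bigA _ (fun ab c => \sum_d F ab.1 ab.2 c d)) /=.
  rewrite (pair_bigA _ (fun abc d => F abc.1.1 abc.1.2 abc.2 d)) /=.
  apply: eq_bigr => -[[[a b] c] d] _ /=.
  rewrite inE is_embedding_quad /F /adj /nadj.
  case: (gadj G a b); last by rewrite !mul0r.
  case: (_ && ~~ gadj G a c); last by rewrite andbF mulr0 !mul0r.
  case: (gadj G b c); last by rewrite mulr0 mul0r.
  by case: (_ && ~~ gadj G a d); case: (c != d); rewrite /= ?(mul1r, mulr0, mul0r).
apply: eq_bigr => a _; rewrite mulr_sumr; apply: eq_bigr => b _.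
rewrite mulr_sumr; apply: eq_bigr => c _; rewrite /F -mulr_sumr mulrC.
(* When ac is a non-edge, c is itself counted in the codegree of a; excluding d = c gives the factor
   [codeg a - 1]. *)
have [->|ac] := eqVneq (nadj (gadj G) a c : R) 0; first by rewrite !(mulr0, mul0r).
congr (_ * _).
have nadj1 : nadj (gadj G) a c = 1 :> R.
  by move: ac; rewrite /nadj; case: (_ && _); rewrite ?eqxx.
rewrite /codeg (bigD1 c) //= [in RHS](bigD1 c) //= nadj1 eqxx mulr0 add0r addrAC subrr add0r.
by apply: eq_bigr => d dc; rewrite eq_sym dc mulr1.
Qed.

End Graphs.

(** * Densities, their limits and the maximizer *)

Section Limits.
Context {R : realType}.
Implicit Types (n : nat) (a : R).

Lemma densityE n (G : sgraph 'I_n) :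
  density R H G = num_emb (gadj G) / (n ^_ 4)%:R.
Proof. by rewrite /density num_embeddingsE !card_ord. Qed.

Lemma ffact4E n : (n ^_ 4)%:R = n%:R * (n%:R - 1) * (n%:R - 2) * (n%:R - 3) :> R.
Proof.
have [n4|] := ltnP n 4.
  by rewrite ffact_small //; move: n n4 => [|[|[|[|//]]]] _; ring.
case: n => [|[|[|[|n]]]] // _.
by rewrite !ffactnS ffactn0 /=; ring.
Qed.

Lemma ffact4_gt0 n : (4 <= n)%N -> 0 < (n ^_ 4)%:R :> R.
Proof. by move=> n4; rewrite ltr0n ffact_gt0. Qed.

Lemma part_card_ratio n (p : {ffun 'I_n -> 'I_2}) : (0 < n)%N ->
  part_card (fun x => p x == 0) = part_ratio R p 0 * n%:R.
Proof.
move=> n0; rewrite /part_ratio divfK ?pnatr_eq0 -?lt0n //.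
rewrite -sum1_card natr_sum [RHS]big_mkcond /=.
by apply: eq_bigr => x _; rewrite inE; case: (_ == _).
Qed.

(* The density of a bipartite blowup, as a function of the fraction [x] of
   vertices in the first part and of [h = 1/n]. *)
Definition bip_density (x h : R) : R :=
  (x * (1 - x)) * (1 - 3 * h + 4 * h ^+ 2 - 2 * (x * (1 - x))) /
  ((1 - h) * (1 - 2 * h) * (1 - 3 * h)).

Lemma density_blowup n (p : {ffun 'I_n -> 'I_2}) : (4 <= n)%N ->
  density R H (blowup (complete_graph 2) p) =
  bip_density (part_ratio R p 0) n%:R^-1.
Proof.
move=> n4; rewrite densityE gadj_blowup ffact4E.
set q := fun x => p x == 0.
have := num_emb_bip q (R := R).
rewrite ord_edges_bip part_card_ratio ?card_ord; last by apply: leq_trans n4.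
set x := part_ratio R p 0; set e := num_emb _ => eE.
have {eE} -> : e = (x * (1 - x)) * n%:R ^+ 2 *
    (n%:R ^+ 2 - 3 * n%:R + 4 - 2 * ((x * (1 - x)) * n%:R ^+ 2)).
  by lra.
have n4' : 4 <= n%:R :> R by rewrite ler_nat.
rewrite /bip_density; field.
by rewrite !gt_eqF //; lra.
Qed.

Lemma cvg_invn : (n%:R^-1 @[n --> \oo] --> (0 : R))%classic.
Proof. by rewrite -cvg_shiftS; exact: cvg_harmonic. Qed.

Lemma bip_density_cvg (x : nat -> R) a :
  (x n @[n --> \oo] --> a)%classic ->
  (bip_density (x n) n%:R^-1 @[n --> \oo] --> a * (1 - a) * (1 - 2 * (a * (1 - a))))%classic.
Proof.
move=> xa; have h0 := cvg_invn.
have cst (b : R) : (b @[n --> \oo] --> b)%classic by exact: cvg_cst.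
have scale (b l : R) (u : nat -> R) : (u n @[n --> \oo] --> l)%classic ->
    (b * u n @[n --> \oo] --> b * l)%classic by move=> ul; apply: cvgM.
have -> : a * (1 - a) * (1 - 2 * (a * (1 - a))) = bip_density a 0.
  by rewrite /bip_density; field.
have y : (x n * (1 - x n) @[n --> \oo] --> a * (1 - a))%classic.
  by apply: cvgM => //; apply: cvgB => //; exact: cst.
apply: cvgM.
  apply: cvgM => //; apply: cvgB; last exact: scale.
  apply: cvgD; first by apply: cvgB; [exact: cst|exact: scale].
  by apply: scale; rewrite expr2; apply: cvgM.
apply: cvgV; first by rewrite !(mulr0, subr0, mulr1) oner_eq0.
apply: cvgM; last by apply: cvgB; [exact: cst|exact: scale].
by apply: cvgM; apply: cvgB => //; exact: scale.
Qed.

Definition threshold n (k : nat) : {ffun 'I_n -> 'I_2} :=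
  [ffun x : 'I_n => if (x < k)%N then 0 else 1].

Lemma part_ratio_threshold n k : (k <= n)%N ->
  part_ratio R (threshold n k) 0 = k%:R / n%:R.
Proof.
move=> kn; rewrite /part_ratio -sum1_card; congr (_%:R / _).
rewrite (eq_bigl (fun x : 'I_n => x < k)%N) => [|x].
  by rewrite -(big_ord_widen n (fun=> 1%N)) // sum1_card card_ord.
by rewrite inE ffunE; case: (x < k)%N.
Qed.

Lemma part_ratio_compl n (p : {ffun 'I_n -> 'I_2}) : (0 < n)%N ->
  part_ratio R p 1 = 1 - part_ratio R p 0.
Proof.
move=> n0; rewrite /part_ratio.
have -> : [set x | p x == 1] = ~: [set x | p x == 0].
  by apply/setP => x; rewrite !inE; case: (p x) => [[|[|?]] ?].
rewrite cardsCs finset.setCK card_ord natrB; last first.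
  by rewrite -[X in (_ <= X)%N]card_ord max_card.
by rewrite mulrBl divff // pnatr_eq0 -lt0n.
Qed.

Lemma cvg_trunc a : 0 <= a ->
  ((Num.truncn (a * n%:R))%:R / n%:R @[n --> \oo] --> a)%classic.
Proof.
move=> a0; apply: (@squeeze_cvgr _ _ _ _ (fun n => a - n%:R^-1) (fun=> a)).
- near=> n.
  have n0 : 0 < n%:R :> R by near: n; exact: nbhs_infty_gtr.
  have an0 : 0 <= a * n%:R by rewrite mulr_ge0 // ltW.
  have /andP[le1 lt1] := truncn_itv an0.
  rewrite ler_pdivrMr // ler_pdivlMr // le1 andbT mulrBl mulVf ?gt_eqF //.
  by rewrite lerBlDr; move: lt1; rewrite -natr1 => /ltW.
- by rewrite -[X in (_ --> X)%classic]subr0; apply: cvgB; [exact: cvg_cst|exact: cvg_invn].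
- exact: cvg_cst.
Unshelve. all: by end_near. Qed.

Lemma blowup_densityE (a : 'rV[R]_2) : in_simplex a ->
  blowup_density H (complete_graph 2) a =
  a 0 0 * (1 - a 0 0) * (1 - 2 * (a 0 0 * (1 - a 0 0))).
Proof.
move=> [a0 a1].
have lim (p : forall n, {ffun 'I_n -> 'I_2}) :
    (part_ratio R (p n) 0 @[n --> \oo] --> a 0 0)%classic ->
    (density R H (blowup (complete_graph 2) (p n)) @[n --> \oo] -->
      a 0 0 * (1 - a 0 0) * (1 - 2 * (a 0 0 * (1 - a 0 0))))%classic.
  move=> pa; apply: cvg_trans (bip_density_cvg _ _ pa); apply: near_eq_cvg.
  by near=> n; rewrite density_blowup //; near: n; exact: nbhs_infty_ge.
apply: get_unique => [p pa|l lP]; first exact/lim/pa.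
have aE : a 0 1 = 1 - a 0 0.
  have l1 : lift ord0 ord0 = 1 :> 'I_2 by exact: val_inj.
  by move: a1; rewrite big_ord_recl big_ord1 l1; lra.
(* Uniqueness of the limit needs at least one sequence of partitions with the prescribed ratios;
   without one, every [l] would qualify. *)
pose p n := threshold n (Num.truncn (a 0 0 * n%:R)).
have p0 n : part_ratio R (p n) 0 = (Num.truncn (a 0 0 * n%:R))%:R / n%:R.
  apply: part_ratio_threshold; rewrite -(ler_nat R).
  apply: (@le_trans _ _ (a 0 0 * n%:R)); first by rewrite truncn_le mulr_ge0.
  by rewrite ler_piMl //; have := a0 1; lra.
have ratio0 : (part_ratio R (p n) 0 @[n --> \oo] --> a 0 0)%classic.
  by rewrite (eq_cvg _ _ p0); exact: cvg_trunc.
have ratio1 : (part_ratio R (p n) 1 @[n --> \oo] --> a 0 1)%classic.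
  have : (1 - part_ratio R (p n) 0 @[n --> \oo] --> a 0 1)%classic.
    by rewrite aE; apply: cvgB => //; exact: cvg_cst.
  apply: cvg_trans; apply: near_eq_cvg.
  by near=> n; rewrite part_ratio_compl //; near: n; exact: nbhs_infty_ge.
have ratio i : (part_ratio R (p n) i @[n --> \oo] --> a 0 i)%classic.
  have [->//|->//] : i = 0 \/ i = 1.
  by case: i => [[|[|//]] ?]; [left|right]; apply: val_inj.
exact: cvg_unique (lP p ratio) (lim p ratio0).
Unshelve. all: by end_near. Qed.

(** With y = x(1 - x), the density is y(1 - 2y) = 1/8 - 2(y - 1/4)^2, and y = 1/4 forces x = 1/2. *)
Lemma maximizer_half (a : 'rV[R]_2) :
  is_maximizer H (complete_graph 2) a <-> a = const_mx (1 / 2).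
Proof.
have half_simplex : in_simplex (const_mx (1 / 2) : 'rV[R]_2).
  split=> [i|]; first by rewrite mxE; lra.
  rewrite big_ord_recl big_ord1 !mxE. lra.
split=> [[a_simplex /(_ _ half_simplex)]|->].
  rewrite !blowup_densityE // mxE.
  set x := a 0 0; set y := x * (1 - x) => le_half.
  have y4 : y = 1 / 4.
    have : (y - 1 / 4) ^+ 2 <= 0 by rewrite expr2; lra.
    by rewrite le_eqVlt ltNge sqr_ge0 orbF sqrf_eq0 => /eqP; lra.
  have x2 : x = 1 / 2.
    have : (x - 1 / 2) ^+ 2 = 0 by move: y4; rewrite /y expr2; lra.
    by move/eqP; rewrite sqrf_eq0 => /eqP; lra.
  have [_] := a_simplex; rewrite big_ord_recl big_ord1 -/x => a1.
  apply/rowP => i; rewrite mxE.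
  have [->//|->] : i = 0 \/ i = lift ord0 ord0.
    by case: i => [[|[|//]] ?]; [left|right]; apply: val_inj.
  lra.
split=> // b b_simplex; rewrite !blowup_densityE // mxE.
set x := b 0 0; have := sqr_ge0 (x * (1 - x) - 1 / 4); rewrite expr2; lra.
Qed.

Lemma density_le_max n (G : sgraph 'I_n) : density R H G <= max_density R H n.
Proof. by rewrite /max_density; exact: le_bigmax. Qed.

Lemma max_density_cvg : (max_density R H n @[n --> \oo] --> (1 / 8 : R))%classic.
Proof.
have cst (b : R) : (b @[n --> \oo] --> b)%classic by exact: cvg_cst.
(* This is the bound of [num_emb_upper] with its quadratic in the number of edges replaced by its
   maximum. *)
pose u n : R := ((1 - 3 * n%:R^-1 + 4 * n%:R^-1 ^+ 2) ^+ 2 / 8 + n%:R^-1) /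
  ((1 - n%:R^-1) * (1 - 2 * n%:R^-1) * (1 - 3 * n%:R^-1)).
pose p n := threshold n (Num.truncn (1 / 2 * n%:R : R)).
apply: (@squeeze_cvgr _ _ _ _ (fun n => density R H (blowup (complete_graph 2) (p n))) u).
- near=> n; rewrite density_le_max /=.
  have n4 : (4 <= n)%N by near: n; exact: nbhs_infty_ge.
  have density_le (G : sgraph 'I_n) : density R H G <= u n.
    rewrite densityE ler_pdivrMr ?ffact4_gt0 // ffact4E.
    have := num_emb_upper _ (gadj_sym G) (gadj_irr G) (R := R).
    rewrite card_ord; set D := ord_edges _; set e := num_emb _ => e_le.
    have n4' : 4 <= n%:R :> R by rewrite ler_nat.
    have -> : u n * (n%:R * (n%:R - 1) * (n%:R - 2) * (n%:R - 3)) =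
      (n%:R ^+ 2 - n%:R *+ 3 + 4) ^+ 2 / 8 + n%:R ^+ 3.
      by rewrite /u; field; rewrite !gt_eqF //; lra.
    have := sqr_ge0 (D - (n%:R ^+ 2 - n%:R *+ 3 + 4) / 2).
    rewrite !expr2 in e_le *; lra.
  (* The default value 0 of the maximum must also lie below [u n]; any graph of order n shows
     this. *)
  apply: bigmax_le => // ; apply: le_trans (density_le (blowup (complete_graph 2) (p n))).
  by rewrite divr_ge0 ?ler0n.
- have -> : 1 / 8 = 1 / 2 * (1 - 1 / 2) * (1 - 2 * (1 / 2 * (1 - 1 / 2))) :> R.
    by field.
  apply: cvg_trans (bip_density_cvg _ _ (@cvg_trunc (1 / 2) _)) => //.
  apply: near_eq_cvg; near=> n.
  have n4 : (4 <= n)%N by near: n; exact: nbhs_infty_ge.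
  rewrite density_blowup // part_ratio_threshold // -(ler_nat R).
  have := @truncn_le R (1 / 2 * n%:R); rewrite mulr_ge0 // => ?.
  by have := ler0n R n; lra.
- have h0 := cvg_invn.
  have -> : 1 / 8 = ((1 - 3 * 0 + 4 * 0 ^+ 2) ^+ 2 / 8 + 0) /
    ((1 - 0) * (1 - 2 * 0) * (1 - 3 * 0)) :> R by field.
  have scale (b l : R) (v : nat -> R) : (v n @[n --> \oo] --> l)%classic ->
      (b * v n @[n --> \oo] --> b * l)%classic by move=> ul; apply: cvgM.
  apply: cvgM.
    apply: cvgD => //; apply: cvgM; last exact: cst.
    have sq : (1 - 3 * n%:R^-1 + 4 * n%:R^-1 ^+ 2 @[n --> \oo] --> (1 - 3 * 0 + 4 * 0 ^+ 2 : R))%classic.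
      apply: cvgD; first by apply: cvgB; [exact: cst|exact: scale].
      by apply: scale; rewrite expr2; apply: cvgM.
    by rewrite expr2; apply: cvgM.
  apply: cvgV; first by rewrite !(mulr0, subr0, mulr1) oner_eq0.
  apply: cvgM; last by apply: cvgB; [exact: cst|exact: scale].
  by apply: cvgM; apply: cvgB => //; exact: scale.
Unshelve. all: by end_near. Qed.

(** * Stability *)

Lemma ler_sqr_norm (x y : R) : `|x| <= y -> x ^+ 2 <= y ^+ 2.
Proof.
move=> xy; rewrite -[x ^+ 2]real_normK ?num_real //.
by rewrite lerXn2r ?nnegrE // (le_trans _ xy).
Qed.

(* With [u] and [w] the excess edge counts of the given graph and of the
   bipartite graph found near it, either [u ^+ 2 - w ^+ 2] is absorbed by the
   defect, or the graph is so far from optimal that comparing with the balanced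
   bipartite graph ([w1]) suffices. *)
Lemma deficit_ge (k n N L M m u w w1 z : R) :
  0 < k <= 1 -> 512 <= k ^+ 2 * n ^+ 2 ->
  L = N ^+ 2 / 4 - u ^+ 2 - z -> k * (n ^+ 2 * m) <= z ->
  `|u - w| <= m -> N ^+ 2 / 4 - w ^+ 2 <= M ->
  N ^+ 2 / 4 - w1 ^+ 2 <= M -> `|w1| <= 2 * n -> 0 <= m <= n ^+ 2 ->
  k ^+ 2 * (n ^+ 2 * m) <= 128 * (M - L).
Proof.
move=> /andP[k0 k1] kn -> zm uw Mw Mw1 w1n /andP[m0 mn].
have n20 : 0 <= n ^+ 2 by exact: sqr_ge0.
have nm0 : 0 <= n ^+ 2 * m by rewrite mulr_ge0.
have kk : k ^+ 2 * (n ^+ 2 * m) <= k * (n ^+ 2 * m).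
  by rewrite expr2 -mulrA ler_piMl // mulr_ge0 // ltW.
have knm0 : 0 <= k * (n ^+ 2 * m) by rewrite mulr_ge0 // ltW.
(* In the close case, [w ^+ 2 - u ^+ 2] is at most half of [z]. *)
have [close|far] := lerP `|u + w| (k * n ^+ 2 / 2).
  have : `|(w - u) * (u + w)| <= m * (k * n ^+ 2 / 2).
    by rewrite normrM ler_pM // distrC.
  have := ler_norm ((w - u) * (u + w)); rewrite !expr2 in Mw kk zm knm0 *; lra.
have w1sq : w1 ^+ 2 <= 4 * n ^+ 2.
  by have := ler_sqr_norm _ _ w1n; rewrite exprMn; lra.
(* Either [m] is large, and so is [z], or [u] and [w] are close and [u] alone is large. The
   hypothesis with 512 then makes [w1 ^+ 2] at most half of this gain. *)
have gap : k ^+ 2 * n ^+ 2 * n ^+ 2 <= 64 * (u ^+ 2 + z).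
  have [mbig|msmall] := lerP (k * n ^+ 2 / 4) m.
    have : k * n ^+ 2 * (k * n ^+ 2 / 4) <= k * n ^+ 2 * m.
      by rewrite ler_wpM2l // mulr_ge0 // ltW.
    have := sqr_ge0 u; have := sqr_ge0 (k * n ^+ 2).
    rewrite !expr2 in zm *; lra.
  have ubig : k * n ^+ 2 / 8 <= `|u|.
    have := ler_normD (u + u) (w - u); rewrite distrC.
    have -> : u + u + (w - u) = u + w by ring.
    have := ler_normD u u; lra.
  have : (k * n ^+ 2 / 8) ^+ 2 <= `|u| ^+ 2.
    have kn0 : 0 <= k * n ^+ 2 by rewrite mulr_ge0 // ltW.
    by rewrite lerXn2r ?nnegrE //; lra.
  rewrite real_normK ?num_real //; rewrite !expr2 in zm knm0 *; lra.
have : 512 * n ^+ 2 <= k ^+ 2 * n ^+ 2 * n ^+ 2 by rewrite ler_wpM2r.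
have : k ^+ 2 * n ^+ 2 * m <= k ^+ 2 * n ^+ 2 * n ^+ 2.
  by rewrite ler_wpM2l // mulr_ge0 // sqr_ge0.
rewrite mulrA; lra.
Qed.

Lemma balanced_gap n (q := fun x => threshold n n./2 x == 0) : (2 <= n)%N ->
  `|ord_edges (bip q) - (n%:R ^+ 2 - n%:R *+ 3 + 4) / 2| <= 2 * n%:R :> R.
Proof.
move=> n2; have n0 : (0 < n)%N by apply: leq_trans n2.
have n0' : (n%:R : R) != 0 by rewrite pnatr_eq0 -lt0n.
rewrite ord_edges_bip card_ord part_card_ratio // part_ratio_threshold; last first.
  by rewrite -divn2 leq_div.
rewrite divfK //.
have nE : n%:R = (odd n)%:R + (n./2)%:R *+ 2 :> R.
  by rewrite -{1}(odd_double_half n) natrD -muln2 natrM mulr_natr.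
have n2' : 2 <= n%:R :> R by rewrite ler_nat.
rewrite ler_norml; move: nE n2'; case: (odd n) => /= ->; nra.
Qed.

(** Here [L] is below n^4/5 while [M] is close to n^4/4 or larger, so the deficit has order n^4 and
    exceeds any edit distance times n^2, up to the constant. *)
Lemma far_deficit (k n N L M m Q w1 : R) :
  0 < k <= 1 -> 100 <= n -> N = n ^+ 2 - n *+ 3 + 4 ->
  L <= n * Q *+ 2 -> Q < n ^+ 3 / 10 ->
  N ^+ 2 / 4 - w1 ^+ 2 <= M -> `|w1| <= 2 * n -> 0 <= m <= n ^+ 2 ->
  k ^+ 2 * (n ^+ 2 * m) <= 128 * (M - L).
Proof.
move=> /andP[k0 k1] n100 NE LQ Qn Mw1 w1n /andP[m0 mn].
have n20 : 0 <= n ^+ 2 by exact: sqr_ge0.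
have w1sq : w1 ^+ 2 <= 4 * n ^+ 2.
  by have := ler_sqr_norm _ _ w1n; rewrite exprMn; lra.
have : k ^+ 2 * (n ^+ 2 * m) <= n ^+ 2 * n ^+ 2.
  have k21 : k ^+ 2 <= 1 by rewrite exprn_ile1 // ltW.
  apply: (@le_trans _ _ (n ^+ 2 * m)); first by rewrite ler_piMl // mulr_ge0.
  by rewrite ler_wpM2l.
have : n * Q <= n * (n ^+ 3 / 10) by rewrite ler_wpM2l //; lra.
have : (n ^+ 2 - n *+ 3) ^+ 2 <= N ^+ 2.
  have : 100 * n <= n ^+ 2 by rewrite expr2 ler_wpM2r //; lra.
  by move=> ?; rewrite NE lerXn2r ?nnegrE; lra.
have : 100 * n ^+ 3 <= n * n ^+ 3 by rewrite ler_wpM2r // exprn_ge0; lra.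
have : 100 * n ^+ 2 <= n * n ^+ 2 by rewrite ler_wpM2r.
move: LQ w1sq Mw1 n20; clear; rewrite !exprS !expr0; lra.
Qed.

Lemma stable_H : perfectly_stable R H (complete_graph 2).
Proof.
have [K K1 near_bip] : exists2 K : R, 1 <= K &
    forall (T : finType) (A : rel T), symmetric A -> irreflexive A ->
    800 <= #|T|%:R :> R -> #|T|%:R ^+ 3 / 10 <= \sum_x deg A x * codeg A x :> R ->
    exists c, #|T|%:R ^+ 2 * mismatch A c <= K * defect A.
  exists stab_const; first by rewrite /stab_const ler1n.
  move=> T A Asym Airr n_ge Q_ge.
  exact: exists_mismatch_le A Asym Airr n_ge Q_ge.
have K0 : 0 < K by lra.
set k := K^-1; have k0 : 0 < k by rewrite invr_gt0.
have k1 : k <= 1 by rewrite invf_le1.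
have k20 : 0 < k ^+ 2 by rewrite exprn_gt0.
have k01 : 0 < k <= 1 by rewrite k0.
(* Hiding the numeral keeps [done] from computing with it in unary. *)
have [B BE] : exists B : R, B = 1024 by exists 1024.
(* [B] has to exceed 800 for [near_bip], 512 for [deficit_ge], and 256 = 2 * 128 for turning doubled
   counts into densities. *)
exists (B / k ^+ 2).
have C_ge : B <= B / k ^+ 2.
  apply: ler_peMr; first lra.
  by rewrite invf_ge1 // exprn_ile1 // ltW.
split; [by lra|by rewrite card_ord; lra|move=> n G Cn].
have n_ge : B <= n%:R :> R by exact: le_trans Cn.
have n4 : (4 <= n)%N by rewrite -(ler_nat R); lra.
set N : R := n%:R ^+ 2 - n%:R *+ 3 + 4.
set M : R := max_density R H n * (n ^_ 4)%:R *+ 2.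
set L : R := num_emb (gadj G) *+ 2.
have kn : 512 <= k ^+ 2 * n%:R ^+ 2.
  have : B <= k ^+ 2 * n%:R by rewrite mulrC -ler_pdivrMr.
  have : k ^+ 2 * n%:R <= k ^+ 2 * n%:R ^+ 2.
    by rewrite (ler_wpM2l (ltW k20)) // expr2 ler_peMr //; lra.
  lra.
have ff_gt0 : 0 < (n ^_ 4)%:R :> R := ffact4_gt0 n n4.
(* Completing the square: D(N - D) = N^2/4 - (D - N/2)^2, so [w] is the excess over the optimal
   number of ordered edges. *)
have M_ge (p : {ffun 'I_n -> 'I_2}) (w := ord_edges (bip (fun x => p x == 0)) - N / 2) :
    N ^+ 2 / 4 - w ^+ 2 <= M.
  have := density_le_max n (blowup (complete_graph 2) p) : _ <= _ :> R.
  rewrite densityE gadj_blowup ler_pdivrMr //.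
  have := num_emb_bip (fun x => p x == 0) (R := R).
  rewrite card_ord -/N /M /w; set D := ord_edges _; set e := num_emb _.
  by rewrite !expr2; lra.
suff [q le_q] : exists p : {ffun 'I_n -> 'I_2},
    k ^+ 2 * (n%:R ^+ 2 * (edit_dist G (blowup (complete_graph 2) p))%:R)
      <= 128 * (M - L).
  exists q; set m := (edit_dist _ _)%:R in le_q *.
  have LM : M - L = 2 * (n ^_ 4)%:R * (max_density R H n - density R H G).
    by rewrite densityE /M /L; field; rewrite gt_eqF.
  have d0 : 0 <= max_density R H n - density R H G.
    by rewrite subr_ge0 density_le_max.
  have ff_le : (n ^_ 4)%:R <= n%:R ^+ 4 :> R.
    have -> : n%:R ^+ 4 = n%:R * n%:R * n%:R * n%:R :> R by ring.
    by rewrite ffact4E !ler_pM ?mulr_ge0 //; lra.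
  have n20 : 0 < n%:R ^+ 2 :> R by rewrite exprn_gt0; lra.
  have {}le_q : k ^+ 2 * m <= B * ((max_density R H n - density R H G) * n%:R ^+ 2).
    rewrite -(ler_pM2l n20) mulrCA; apply: (le_trans le_q); rewrite LM.
    have := ler_wpM2r d0 ff_le; have := mulr_ge0 d0 (ler0n R (n ^_ 4)).
    by move: (_ - _) => d; rewrite BE !exprS expr0; lra.
  have -> (d x : R) : B / k ^+ 2 * d * x = (k ^+ 2)^-1 * (B * (d * x)) by ring.
  by rewrite ler_pdivlMl.
have balanced := M_ge (threshold n n./2).
have gap : `|_| <= 2 * n%:R := balanced_gap n (ltnW (ltnW n4)).
have n2_max (F : 'I_n -> 'I_n -> bool) : 0 <= \sum_x \sum_y (F x y)%:R :> R /\
    \sum_x \sum_y (F x y)%:R <= n%:R ^+ 2 :> R.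
  split; first by do 2!(apply: sumr_ge0 => ? _).
  apply: (@le_trans _ _ (\sum_(x < n) \sum_(y < n) 1)).
    by apply: sum2_le => x y; case: (F x y).
  by rewrite sumr_const sumr_const !card_ord -mulrnA -natrX mulnn.
have [Q_ge|Q_lt] := lerP (n%:R ^+ 3 / 10)
    (\sum_x deg (gadj G) x * codeg (gadj G) x : R); last first.
  (* Any blowup would do here, as the deficit already has order n^4; this one is edgeless. *)
  pose p0 : {ffun 'I_n -> 'I_2} := [ffun=> 0]; exists p0.
  have [_ m_le] :=
    n2_max (fun x y => gadj G x y != ((p0 x == 0) != (p0 y == 0))).
  have e_le := edit_dist_le R G p0.
  apply: far_deficit k01 _ (erefl N) _ Q_lt balanced gap _; first lra.
    have := num_emb_le _ (gadj_irr G) (R := R).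
    by rewrite card_ord /L; lra.
  by rewrite ler0n (le_trans e_le).
have := near_bip _ _ (gadj_sym G) (gadj_irr G); rewrite card_ord.
case=> [|//|c cP]; first lra.
pose p := [ffun x => if gadj G c x then 0 else 1 : 'I_2].
have pE : (fun x => p x == 0) = gadj G c.
  by apply/funext => x; rewrite ffunE; case: (gadj G c x).
exists p.
have e_le : (edit_dist G (blowup (complete_graph 2) p))%:R <= mismatch (gadj G) c :> R.
  apply: (le_trans (edit_dist_le R G p)).
  by apply: sum2_le => x y; rewrite -!(congr1 (fun f => f _) pE).
apply: (@le_trans _ _ (k ^+ 2 * (n%:R ^+ 2 * mismatch (gadj G) c))).
  by rewrite !ler_wpM2l ?sqr_ge0.
have := M_ge p; rewrite pE => Mw.
have LE : L = N ^+ 2 / 4 - (ord_edges (gadj G) - N / 2) ^+ 2 - defect (gadj G).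
  rewrite /L num_emb_defect ?card_ord; [|exact: gadj_sym|exact: gadj_irr].
  by rewrite -/N; field.
apply: deficit_ge k01 kn LE _ _ Mw balanced gap (introT andP (n2_max _)).
  by rewrite ler_pdivrMl.
have := ord_edges_mismatch R _ (gadj G) c.
by apply: le_trans; rewrite opprB addrA subrK.
Qed.

End Limits.

Theorem theorem3p11 (R : realType) :
  [/\ (max_density R H n @[n --> \oo] --> (1 / 8 : R))%classic,
      perfectly_stable R H (complete_graph 2)
    & forall a : 'rV[R]_2,
        is_maximizer H (complete_graph 2) a <-> a = const_mx (1 / 2)].
Proof.
split; [exact: max_density_cvg|exact: stable_H|exact: maximizer_half].
Qed.
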